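(* Let $d>1$. The poset $\Pi_n^d$ of balanced partitions is the upper order ideal of $\Pi_{n,d}$ that is generated by the $\mathfrak S_n$-orbit of the element $\pi=B_0/B_1/\cdots/B_{a(d)}$, where $a(d)=\lfloor n/d\rfloor$, $$B_0=\{0\}\cup\{a(d)\cdot d+1,\ a(d)\cdot d+2,\ \ldots,\ n\},$$ and, for $1\le i\le a(d)$, $$B_i=\{((i-1)d+1)^0,\ ((i-1)d+2)^1,\ \ldots,\ (id)^{d-1}\},$$ superscripts denoting weights in $\mathbb Z/d\mathbb Z$.
   Context: A ($d$-)weighted partition of $\{0,1,\ldots,n\}$ is a set partition $B_0/B_1/\cdots/B_\ell$ of $\{0,1,\ldots,n\}$ with $0\in B_0$ (the zero block), together with a weight in $\mathbb Z/d\mathbb Z$ assigned to each element of $B_1\cup\cdots\cup B_\ell$ (written as a superscript); elements of $B_0$ are unweighted. For a nonzero block $B$ and $w\in\mathbb Z/d\mathbb Z$, $B^w$ is the block obtained by adding $w$ to the weight of each element of $B$, and $B^{\mathrm{erase}}$ is the block obtained by removing all weights (for the zero block, $B_0^{\mathrm{erase}}=B_0$). Weighted partitions are identified if they differ by replacing nonzero blocks $B$ by shifts $B^w$. The Dowling lattice $\Pi_{n,d}$ is the set of $d$-weighted partitions (up to this identification), with $\pi_1\le\pi_2$ if for each block $B$ of $\pi_1$ there is a block of $\pi_2$ that either contains $B^{\mathrm{erase}}$ or contains $B^w$ for some $w$. $\mathfrak S_n$ acts on $\Pi_{n,d}$ by $\sigma(B_0/\cdots/B_\ell)=\sigma B_0/\cdots/\sigma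 B_\ell$ (fixing $0$, elements carrying their weights along). A partition in $\Pi_{n,d}$ is balanced if in each block all weights $w\in\mathbb Z/d\mathbb Z$ appear with equal multiplicity (vacuous for the zero block). $\Pi_n^d$ is the subposet of all balanced partitions. An upper order ideal of a poset $P$ is a subset $I$ such that $x\in I$, $x\le y$ imply $y\in I$; its minimal elements are its generators. *)

(* Defs.v *)
From HB Require Import structures.
From mathcomp Require Import all_boot all_order all_fingroup all_algebra.
From mathcomp Require Import generic_quotient.

Set Implicit Arguments.
Unset Strict Implicit.
Unset Printing Implicit Defensive.

Import Order.TTheory GRing.Theory.
Local Open Scope ring_scope.

(* Throughout, {0, ..., n} is 'I_n.+1, and the d weights are the elements of   *)
(* 'Z_d; recall that 'Z_d is Z/dZ only when d > 1.                             *)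

(** * Weighted partitions *)

(* A pair (set partition of {0, ..., n}, weights), where the elements of the   *)
(* zero block, and only these, have weight None.                               *)
Definition is_wpart n d
    (p : {set {set 'I_n.+1}} * {ffun 'I_n.+1 -> option 'Z_d}) : bool :=
  partition p.1 [set: 'I_n.+1] &&
  [forall i, (p.2 i == None) == (i \in pblock p.1 ord0)].

Record wpart n d := WPart {
  wpart_val :> {set {set 'I_n.+1}} * {ffun 'I_n.+1 -> option 'Z_d};
  wpartP : is_wpart wpart_val }.

HB.instance Definition _ n d := [isSub for @wpart_val n d].
HB.instance Definition _ n d := [Finite of wpart n d by <:].

(* A block with weights as superscripts: (i, Some w) stands for i^w, and       *)
(* (i, None) for an unweighted i.                                              *)
Definition wblock n d (p : wpart n d) (B : {set 'I_n.+1}) :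
    {set 'I_n.+1 * option 'Z_d} :=
  [set (i, p.2 i) | i in B].

Definition blocks n d (p : wpart n d) : {set {set 'I_n.+1 * option 'Z_d}} :=
  [set wblock p B | B in p.1].

(* B^w; this leaves unweighted elements, hence the zero block, unchanged.      *)
Definition bshift n d (w : 'Z_d) (B : {set 'I_n.+1 * option 'Z_d}) :
    {set 'I_n.+1 * option 'Z_d} :=
  [set (x.1, omap (fun v => v + w) x.2) | x in B].

Definition berase n d (B : {set 'I_n.+1 * option 'Z_d}) :
    {set 'I_n.+1 * option 'Z_d} :=
  [set (x.1, None) | x in B].

Definition weqv n d (p q : wpart n d) : bool :=
  [exists w : {ffun {set 'I_n.+1 * option 'Z_d} -> 'Z_d},
     blocks q == [set bshift (w B) B | B in blocks p]].

Definition wle n d (p q : wpart n d) : bool :=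
  [forall B in blocks p, exists C in blocks q,
     (berase B \subset C) || [exists w, bshift w B \subset C]].

(* On the zero block both multiplicities are 0.                                *)
Definition wbalanced n d (p : wpart n d) : bool :=
  [forall B in blocks p, forall w, forall w',
     #|[set x in B | x.2 == Some w]| == #|[set x in B | x.2 == Some w']|].

Lemma wpart_partition n d (p : wpart n d) : partition p.1 [set: 'I_n.+1].
Proof. by case/andP: (wpartP p). Qed.

Lemma wpart_None n d (p : wpart n d) i :
  (p.2 i == None) = (i \in pblock p.1 ord0).
Proof. by case/andP: (wpartP p) => _ /forallP/(_ i)/eqP. Qed.

Lemma mem_wblock n d (p : wpart n d) B x :
  (x \in wblock p B) = (x.1 \in B) && (x.2 == p.2 x.1).
Proof.
apply/imsetP/andP => [[i iB ->] /=|[xB /eqP xw]]; first by rewrite eqxx.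
by exists x.1; rewrite // -xw; case: x {xB xw}.
Qed.

Lemma blocks_neq0 n d (p : wpart n d) B : B \in blocks p -> B != set0.
Proof.
case/imsetP => B0 B0p ->.
have /and3P[_ _ p0] := wpart_partition p.
have /set0Pn[i iB] : B0 != set0 by apply: contraNneq p0 => <-.
by apply/set0Pn; exists (i, p.2 i); rewrite mem_wblock iB eqxx.
Qed.

Lemma blocks_eq n d (p : wpart n d) B C x y :
  B \in blocks p -> C \in blocks p -> x \in B -> y \in C -> x.1 = y.1 -> B = C.
Proof.
case/imsetP => B0 B0p -> /imsetP[C0 C0p ->].
rewrite !mem_wblock => /andP[xB _] /andP[yC _] exy.
have /and3P[_ /trivIsetP triv _] := wpart_partition p.
congr wblock; apply/eqP/negPn/negP => /(triv _ _ B0p C0p).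
by move/disjoint_setI0/setP/(_ x.1); rewrite !inE xB exy yC.
Qed.

Lemma blocks_weight n d (p : wpart n d) B x :
  B \in blocks p -> x \in B -> x.2 = p.2 x.1.
Proof. by case/imsetP => B0 _ ->; rewrite mem_wblock => /andP[_ /eqP]. Qed.

Lemma blocks_None n d (p : wpart n d) B x y :
  B \in blocks p -> x \in B -> y \in B -> x.2 = None -> y.2 = None.
Proof.
case/imsetP => B0 B0p ->; rewrite !mem_wblock.
case/andP=> xB /eqP -> /andP[yB /eqP ->] /eqP.
have /and3P[_ triv _] := wpart_partition p.
rewrite wpart_None => xz; apply/eqP; rewrite wpart_None.
by rewrite -(same_pblock triv xz) (def_pblock triv B0p xB).
Qed.

Lemma blocks0 n d (p : wpart n d) :
  exists2 B, B \in blocks p & (ord0, None) \in B.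
Proof.
have /and3P[/eqP cov triv _] := wpart_partition p.
exists (wblock p (pblock p.1 ord0)).
  by apply/imset_f/pblock_mem; rewrite cov inE.
rewrite mem_wblock /= mem_pblock cov inE /= eq_sym wpart_None.
by rewrite mem_pblock cov inE.
Qed.

Lemma bshift_shift n d w v (B : {set 'I_n.+1 * option 'Z_d}) :
  bshift w (bshift v B) = bshift (v + w) B.
Proof.
rewrite /bshift -imset_comp; apply: eq_imset => -[i [u|]] //=.
by rewrite addrA.
Qed.

Lemma bshift0 n d (B : {set 'I_n.+1 * option 'Z_d}) : bshift 0 B = B.
Proof.
rewrite -[RHS]imset_id; apply: eq_imset => -[i [u|]] //=.
by rewrite addr0.
Qed.

Lemma berase_berase n d (B : {set 'I_n.+1 * option 'Z_d}) :
  berase (berase B) = berase B.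
Proof. by rewrite /berase -imset_comp; apply: eq_imset. Qed.

Lemma berase_shift n d w (B : {set 'I_n.+1 * option 'Z_d}) :
  berase (bshift w B) = berase B.
Proof. by rewrite /berase -imset_comp; apply: eq_imset. Qed.

Lemma bshift_erase n d w (B : {set 'I_n.+1 * option 'Z_d}) :
  bshift w (berase B) = berase B.
Proof. by rewrite /berase /bshift -imset_comp; apply: eq_imset. Qed.

Lemma wleP n d (p q : wpart n d) :
  reflect (forall B, B \in blocks p -> exists2 C, C \in blocks q &
             (berase B \subset C) || [exists w, bshift w B \subset C])
          (wle p q).
Proof.
apply: (iffP forall_inP) => le_pq B /le_pq.
  by case/exists_inP => C; exists C.
by case=> C Cq BC; apply/exists_inP; exists C.
Qed.

Lemma wle_refl n d : reflexive (@wle n d).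
Proof.
move=> p; apply/wleP => B Bp; exists B => //; apply/orP; right.
by apply/existsP; exists 0; rewrite bshift0.
Qed.

Lemma wle_trans n d : transitive (@wle n d).
Proof.
move=> q p r /wleP le_pq /wleP le_qr; apply/wleP => B /le_pq[C /le_qr[D Dr CD] BC].
exists D => //; case/orP: BC => [BC|/existsP[w BC]].
  apply/orP; left; case/orP: CD => [CD|/existsP[v CD]].
    by rewrite -berase_berase; apply: subset_trans (imsetS _ BC) CD.
  by rewrite -(bshift_erase v); apply: subset_trans (imsetS _ BC) CD.
case/orP: CD => [CD|/existsP[v CD]]; apply/orP; [left|right].
  by rewrite -(berase_shift w); apply: subset_trans (imsetS _ BC) CD.
apply/existsP; exists (w + v).
by rewrite -bshift_shift; apply: subset_trans (imsetS _ BC) CD.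
Qed.

Lemma wle_supp n d (B C : {set 'I_n.+1 * option 'Z_d}) x :
  (berase B \subset C) || [exists w, bshift w B \subset C] -> x \in B ->
  exists2 y, y \in C & x.1 = y.1.
Proof.
case/orP => [/subsetP BC|/existsP[w /subsetP BC]] xB.
  by exists (x.1, None) => //; apply: BC; apply/imsetP; exists x.
exists (x.1, omap (fun v => v + w) x.2) => //.
by apply: BC; apply/imsetP; exists x.
Qed.

Lemma wle_anti_shift n d (p q : wpart n d) B :
  wle p q -> wle q p -> B \in blocks p ->
  exists w, bshift w B \in blocks q.
Proof.
move=> /wleP le_pq /wleP le_qp Bp.
have [C Cq BC] := le_pq _ Bp; have [D Dp CD] := le_qp _ Cq.
have /set0Pn[x xB] := blocks_neq0 Bp.
have [y yC exy] := wle_supp BC xB; have [z zD eyz] := wle_supp CD yC.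
have eDB : D = B.
  by apply: (blocks_eq Dp Bp zD xB); rewrite exy.
have suppCB t : t \in C -> exists2 u, u \in B & t.1 = u.1.
  by rewrite -eDB; apply: wle_supp CD.
have CsubP w : bshift w B \subset C -> bshift w B = C.
  move=> BwC; apply/eqP; rewrite eqEsubset BwC /=; apply/subsetP => t tC.
  have [u uB etu] := suppCB _ tC.
  have uC : (u.1, omap (fun v => v + w) u.2) \in C.
    by apply: (subsetP BwC); apply/imsetP; exists u.
  apply/imsetP; exists u => //.
  rewrite [t]surjective_pairing etu (blocks_weight Cq tC) etu; congr pair.
  by have := blocks_weight Cq uC.
suff [w BwC] : exists w, bshift w B \subset C by exists w; rewrite CsubP.
case/orP: BC => [BC|/existsP//]; exists 0.
suff BN : forall b, b \in B -> b.2 = None.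
  rewrite bshift0; apply/subsetP => b bB; apply: (subsetP BC).
  by apply/imsetP; exists b; rewrite // -(BN b bB); case: (b).
have [Z Zq Z0] := blocks0 q; have [Y Yp Y0] := blocks0 p.
have xC : (x.1, None) \in C by apply: (subsetP BC); apply/imsetP; exists x.
(* C is unweighted, hence is the zero block *)
have eCZ : C = Z.
  case/imsetP: (Cq) => C0 C0q eC; case/imsetP: (Zq) => Z0' Z0q eZ.
  move: xC Z0; rewrite eC eZ !mem_wblock /= => /andP[xC0 xN] /andP[zZ _].
  have /and3P[_ triv _] := wpart_partition q.
  have := wpart_None q x.1; rewrite eq_sym xN (def_pblock triv Z0q zZ) => /esym xZ.
  by rewrite -(def_pblock triv Z0q xZ) (def_pblock triv C0q xC0).
have [|u uB eu] := suppCB (ord0, None); first by rewrite eCZ.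
move=> b; rewrite (blocks_eq Bp Yp uB Y0 (esym eu)) => bY.
exact: blocks_None Yp Y0 bY _.
Qed.

Lemma weqvE n d (p q : wpart n d) : weqv p q = wle p q && wle q p.
Proof.
apply/existsP/andP => [[w /eqP eq_q]|[le_pq le_qp]].
  split; apply/wleP => B.
    move=> Bp; exists (bshift (w B) B); first by rewrite eq_q; apply: imset_f.
    by apply/orP; right; apply/existsP; exists (w B).
  rewrite eq_q => /imsetP[C Cp ->]; exists C => //; apply/orP; right.
  by apply/existsP; exists (- w C); rewrite bshift_shift subrr bshift0.
pose w := [ffun B => odflt 0 [pick v | bshift v B \in blocks q]].
have wP B : B \in blocks p -> bshift (w B) B \in blocks q.
  move=> Bp; rewrite ffunE; case: pickP => [v //|no].
  by have [v] := wle_anti_shift le_pq le_qp Bp; rewrite no.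
exists w; apply/eqP/setP => C; apply/idP/imsetP => [Cq|[B /wP Bq ->//]].
have [v Cp] := wle_anti_shift le_qp le_pq Cq.
exists (bshift v C) => //.
have /set0Pn[x xC] := blocks_neq0 Cq; have := wP _ Cp.
rewrite bshift_shift => Cq'.
apply: (blocks_eq Cq Cq' xC (y := (x.1, omap (fun u => u + (v + w (bshift v C))) x.2))) => //.
by apply/imsetP; exists x.
Qed.

Lemma weqv_refl n d : reflexive (@weqv n d).
Proof. by move=> p; rewrite weqvE wle_refl. Qed.

Lemma weqv_sym n d : symmetric (@weqv n d).
Proof. by move=> p q; rewrite !weqvE andbC. Qed.

Lemma weqv_trans n d : transitive (@weqv n d).
Proof.
move=> q p r; rewrite !weqvE => /andP[pq qp] /andP[qr rq].
by rewrite (wle_trans pq qr) (wle_trans rq qp).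
Qed.

(** * The Dowling lattice *)

Canonical weqv_equiv n d :=
  EquivRel (@weqv n d) (@weqv_refl n d) (@weqv_sym n d) (@weqv_trans n d).

Definition dowling n d := {eq_quot (@weqv_equiv n d)}%qT.

HB.instance Definition _ n d := EqQuotient.on (dowling n d).
HB.instance Definition _ n d := Choice.on (dowling n d).

Definition dpi n d (p : wpart n d) : dowling n d := \pi_(dowling n d)%qT p.

Lemma dpi_repr n d (x : dowling n d) : dpi (repr x) = x.
Proof. exact: reprK. Qed.

HB.instance Definition _ n d : isCountable (dowling n d) :=
  CanIsCountable (@dpi_repr n d).
HB.instance Definition _ n d : isFinite (dowling n d) :=
  CanIsFinite (@dpi_repr n d).

Lemma dpi_eq n d (p q : wpart n d) : (dpi p == dpi q) = weqv p q.
Proof. by rewrite /dpi; apply/idP/idP => [/eqP/eqmodP|H] //; apply/eqP/eqmodP. Qed.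

Lemma weqv_repr n d (p : wpart n d) : weqv (repr (dpi p)) p.
Proof. by rewrite -dpi_eq dpi_repr. Qed.

Definition dowling_le n d (x y : dowling n d) : bool := wle (repr x) (repr y).

Lemma dowling_leE n d (p q : wpart n d) : dowling_le (dpi p) (dpi q) = wle p q.
Proof.
have := weqv_repr p; have := weqv_repr q; rewrite !weqvE /dowling_le.
move=> /andP[q1 q2] /andP[p1 p2].
apply/idP/idP => H; first exact: wle_trans (wle_trans p2 H) q1.
exact: wle_trans (wle_trans p1 H) q2.
Qed.

Lemma dowling_le_refl n d : reflexive (@dowling_le n d).
Proof. by move=> x; apply: wle_refl. Qed.

Lemma dowling_le_anti n d : antisymmetric (@dowling_le n d).
Proof.
move=> x y; rewrite -[x]dpi_repr -[y]dpi_repr !dowling_leE -weqvE -dpi_eq.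
exact: eqP.
Qed.

Lemma dowling_le_trans n d : transitive (@dowling_le n d).
Proof. by move=> y x z; apply: wle_trans. Qed.

Fact dowling_display : Order.disp_t. Proof. exact: (Order.Disp tt tt). Qed.

HB.instance Definition _ n d := Order.Le_isPOrder.Build dowling_display
  (dowling n d) (@dowling_le_refl n d) (@dowling_le_anti n d)
  (@dowling_le_trans n d).

Lemma le_dpi n d (p q : wpart n d) : (dpi p <= dpi q)%O = wle p q.
Proof. exact: dowling_leE. Qed.

(** * The action of the symmetric group *)

(* s : 'S_n permutes 'I_n, i.e. the elements 1, ..., n of 'I_n.+1 via the      *)
(* shift k |-> k + 1; fix0 s is its extension to 'I_n.+1 fixing 0.             *)
Definition fix0 n (s : 'S_n) : 'S_n.+1 := lift_perm ord0 ord0 s.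

Definition wact_val n d (p : wpart n d) (s : 'S_n) :
    {set {set 'I_n.+1}} * {ffun 'I_n.+1 -> option 'Z_d} :=
  ([set [set fix0 s i | i in B] | B : {set 'I_n.+1} in p.1],
   [ffun i => p.2 ((fix0 s)^-1%g i)]).

Lemma wactP n d (p : wpart n d) (s : 'S_n) : is_wpart (wact_val p s).
Proof.
set t := fix0 s; have tinj : injective t := @perm_inj _ t.
have /and3P[/eqP cov triv p0] := wpart_partition p.
have part : partition [set [set t i | i in B] | B : {set 'I_n.+1} in p.1]
                      [set: 'I_n.+1].
  apply/and3P; split.
  - rewrite cover_imset; apply/eqP/setP => i; rewrite inE; apply/bigcupP.
    exists (pblock p.1 (t^-1%g i)); first by apply: pblock_mem; rewrite cov inE.
    by apply/imsetP; exists (t^-1%g i); rewrite ?permKV // mem_pblock cov inE.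
  - apply/trivIsetP => _ _ /imsetP[B Bp ->] /imsetP[C Cp ->] neBC.
    rewrite -setI_eq0 -imsetI; last by move=> x y _ _; apply: tinj.
    have /(trivIsetP triv _ _ Bp Cp)/disjoint_setI0-> : B != C.
      by apply: contraNneq neBC => ->.
    by rewrite imset0.
  - apply/negP => /imsetP[B Bp /esym/eqP].
    by rewrite imset_eq0 => /eqP B0; rewrite -B0 Bp in p0.
apply/andP; split => //=; apply/forallP => i; apply/eqP.
rewrite ffunE wpart_None /= -/t.
have zt : [set t i | i in pblock p.1 ord0] \in
          [set [set t i | i in B] | B : {set 'I_n.+1} in p.1].
  by apply/imset_f/pblock_mem; rewrite cov inE.
have t0 : t ord0 = ord0 by apply: lift_perm_id.
case/and3P: part => _ trivt _.
rewrite (def_pblock trivt zt).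
  by rewrite -{2}[i](permKV t) mem_imset.
by apply/imsetP; exists ord0; rewrite // mem_pblock cov inE.
Qed.

Definition wact n d (p : wpart n d) (s : 'S_n) : wpart n d := WPart (wactP p s).

Definition bact n d (s : 'S_n) (B : {set 'I_n.+1 * option 'Z_d}) :
    {set 'I_n.+1 * option 'Z_d} :=
  [set (fix0 s x.1, x.2) | x in B].

Lemma blocks_act n d (p : wpart n d) s :
  blocks (wact p s) = [set bact s B | B in blocks p].
Proof.
rewrite /blocks -!imset_comp; apply: eq_imset => B /=.
rewrite /wblock /bact -!imset_comp; apply: eq_imset => i /=.
by rewrite ffunE permK.
Qed.

Lemma wact1 n d (p : wpart n d) : wact p 1%g = p.
Proof.
apply/val_inj; rewrite /= /wact_val /fix0 lift_perm1 [RHS]surjective_pairing.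
congr pair; last by apply/ffunP => i; rewrite ffunE invg1 perm1.
rewrite -[RHS]imset_id; apply: eq_imset => B.
by rewrite -[RHS]imset_id; apply: eq_imset => i; rewrite perm1.
Qed.

Lemma wactM n d (p : wpart n d) s t : wact p (s * t)%g = wact (wact p s) t.
Proof.
apply/val_inj; rewrite /= /wact_val /fix0 -(lift_permM _ ord0).
congr pair; last by apply/ffunP => i; rewrite !ffunE invMg permM.
rewrite -imset_comp; apply: eq_imset => B /=.
by rewrite -imset_comp; apply: eq_imset => i; rewrite permM.
Qed.

Lemma wle_act n d (p q : wpart n d) s : wle p q -> wle (wact p s) (wact q s).
Proof.
move/wleP => le_pq; apply/wleP => B; rewrite !blocks_act => /imsetP[C Cp ->].
have [D Dq CD] := le_pq _ Cp; exists (bact s D); first exact: imset_f.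
have eE : berase (bact s C) = bact s (berase C).
  by rewrite /berase /bact -!imset_comp; apply: eq_imset.
have eS w : bshift w (bact s C) = bact s (bshift w C).
  by rewrite /bshift /bact -!imset_comp; apply: eq_imset.
case/orP: CD => [CD|/existsP[w CD]]; apply/orP; [left|right].
  by rewrite eE; apply: imsetS.
by apply/existsP; exists w; rewrite eS; apply: imsetS.
Qed.

Definition dact n d (x : dowling n d) (s : 'S_n) : dowling n d :=
  dpi (wact (repr x) s).

Lemma dactE n d (p : wpart n d) s : dact (dpi p) s = dpi (wact p s).
Proof.
apply/eqP; rewrite dpi_eq weqvE; have := weqv_repr p; rewrite weqvE.
by case/andP=> H1 H2; rewrite !wle_act.
Qed.

Lemma dact1 n d (x : dowling n d) : dact x 1%g = x.
Proof. by rewrite /dact wact1 dpi_repr. Qed.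

Lemma dactM n d (x : dowling n d) : act_morph (@dact n d) x.
Proof. by move=> s t; rewrite -[x]dpi_repr !dactE wactM. Qed.

Canonical dowling_action n d := TotalAction (@dact1 n d) (@dactM n d).

(** * Balanced partitions *)

Lemma wbalanced_eqv n d (p q : wpart n d) :
  weqv p q -> wbalanced p -> wbalanced q.
Proof.
case/existsP => w /eqP eq_q /forall_inP balp; apply/forall_inP => C.
rewrite eq_q => /imsetP[B Bp ->].
have cardE u : #|[set x in bshift (w B) B | x.2 == Some u]| =
               #|[set x in B | x.2 == Some (u - w B)]|.
  pose f (x : 'I_n.+1 * option 'Z_d) := (x.1, omap (fun v => v + w B) x.2).
  have finj : injective f.
    apply: (can_inj (g := fun x => (x.1, omap (fun v => v - w B) x.2))).
    by case=> i [v|] //=; rewrite /f /= addrK.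
  rewrite -(card_imset [set x in B | x.2 == Some (u - w B)] finj).
  apply: eq_card => x; rewrite inE; apply/andP/imsetP.
    case=> /imsetP[y yB ->] /eqP yu; exists y => //; rewrite inE yB.
    move: yu => /=; case: (y.2) => //= a [<-].
    by rewrite addrK.
  case=> y; rewrite inE => /andP[yB /eqP yu] ->.
  by split; [apply/imsetP; exists y | rewrite /= yu /= subrK].
apply/forallP => u; apply/forallP => v; rewrite !cardE.
by have /forallP/(_ (u - w B))/forallP := balp _ Bp.
Qed.

Definition balanced n d (x : dowling n d) : bool := wbalanced (repr x).

Lemma balancedE n d (p : wpart n d) : balanced (dpi p) = wbalanced p.
Proof.
have := weqv_repr p => e; apply/idP/idP; apply: wbalanced_eqv => //.
by rewrite weqv_sym.
Qed.

Definition balanced_partitions n d : {set dowling n d} :=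
  [set x | balanced x].

(** * Upper order ideals *)

Definition upper_order_ideal disp (P : finPOrderType disp) (I : {set P}) :=
  forall x y : P, x \in I -> (x <= y)%O -> y \in I.

Definition generators disp (P : finPOrderType disp) (I : {set P}) : {set P} :=
  [set x in I | [forall y in I, (y <= x)%O ==> (y == x)]].

Definition upper_ideal_gen disp (P : finPOrderType disp) (G : {set P}) :
    {set P} :=
  [set y | [exists x in G, (x <= y)%O]].

(** * The element pi *)

Definition std_zero n d : {set 'I_n.+1} :=
  [set k | (k == ord0) || (n %/ d * d < k)%N].

Definition std_block n d (i : nat) : {set 'I_n.+1} :=
  [set inord (i.-1 * d + j.+1) | j : 'I_d].

(* The weight of k = (i - 1)d + j + 1, with 0 <= j < d, is the class of k - 1, *)
(* i.e. of j; see std_blocks for the blocks with their weights.                *)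
Definition std_val n d :
    {set {set 'I_n.+1}} * {ffun 'I_n.+1 -> option 'Z_d} :=
  (std_zero n d |: [set std_block n d i.+1 | i : 'I_(n %/ d)],
   [ffun k : 'I_n.+1 => if k \in std_zero n d then None else Some (k.-1)%:R]).

Lemma std_inord n d (i : 'I_(n %/ d)) (j : 'I_d) :
  (i.+1.-1 * d + j.+1 <= n %/ d * d)%N /\
  @inord n (i.+1.-1 * d + j.+1) = (i.+1.-1 * d + j.+1)%N :> nat.
Proof.
have H : (i.+1.-1 * d + j.+1 <= n %/ d * d)%N.
  rewrite (@leq_trans (i.+1 * d)) ?leq_mul2r ?ltn_ord ?orbT //.
  by rewrite mulSn /= addnC leq_add2r ltn_ord.
by split=> //; rewrite inordK // ltnS (leq_trans H) ?leq_divM.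
Qed.

Lemma std_blockP n d (i : 'I_(n %/ d)) (k : 'I_n.+1) : (0 < d)%N ->
  (k \in std_block n d i.+1) = (k != ord0) && (k.-1 %/ d == i)%N.
Proof.
move=> d0; apply/imsetP/andP => [[j _ ->]|[k0 /eqP ki]].
  have [_ E] := std_inord i j; split.
    by apply/eqP => /(congr1 val) /=; rewrite E addnS.
  by rewrite E addnS /= divnMDl // (divn_small (ltn_ord j)) addn0.
exists (Ordinal (ltn_pmod k.-1 d0)) => //; apply/val_inj.
have [_ E] := std_inord i (Ordinal (ltn_pmod k.-1 d0)); rewrite [RHS]E.
rewrite /= addnS -ki -divn_eq prednK // lt0n.
by apply: contraNneq k0 => k0; apply/eqP/val_inj.
Qed.

Lemma std_dis n d (i : 'I_(n %/ d)) (k : 'I_n.+1) : (0 < d)%N ->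
  k \in std_zero n d -> k \in std_block n d i.+1 -> False.
Proof.
move=> d0; rewrite inE => /orP kz; rewrite std_blockP // => /andP[k0 /eqP ki].
case: kz => [/eqP kz|]; first by rewrite kz eqxx in k0.
rewrite ltnNge => /negP; apply.
have -> : k = k.-1.+1 :> nat.
  by rewrite prednK // lt0n; apply: contraNneq k0 => k0; apply/eqP/val_inj.
by rewrite -ltn_divLR // ki ltn_ord.
Qed.

Lemma std_valP n d : (1 < d)%N -> is_wpart (std_val n d).
Proof.
move=> /ltnW d0; set P := std_val n d.
have dis i k := @std_dis n d i k d0.
have triv : trivIset P.1.
  apply/trivIsetP => B C BP CP neBC; apply/pred0Pn => -[k /= /andP[kB kC]].
  case/setU1P: BP CP neBC kB kC => [->|/imsetP[i _ ->]] /setU1P[->|/imsetP[j _ ->]] //.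
  - by rewrite eqxx.
  - by move=> _; apply: dis.
  - by move=> _ kB kC; apply: dis kC kB.
  - move=> neBC; rewrite !std_blockP // => /andP[_ /eqP ki] /andP[_ /eqP kj].
    by case/eqP: neBC; rewrite -ki -kj.
apply/andP; split; last first.
  apply/forallP => k; apply/eqP; rewrite /= ffunE.
  rewrite (def_pblock triv (B := std_zero n d)) ?setU11 ?inE //.
  by case: ifP.
apply/and3P; split=> //.
  apply/eqP/setP => k; rewrite inE; apply/bigcupP.
  have [kz|] := boolP (k \in std_zero n d).
    by exists (std_zero n d); rewrite ?setU11.
  rewrite inE negb_or -leqNgt => /andP[k0 kle].
  have ki : (k.-1 %/ d < n %/ d)%N.
    rewrite ltn_divLR // prednK // lt0n.
    by apply: contraNneq k0 => k0; apply/eqP/val_inj.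
  exists (std_block n d (Ordinal ki).+1); first by apply/setU1r/imset_f.
  by rewrite std_blockP // k0 eqxx.
apply/negP => /setU1P[/setP/(_ ord0)|/imsetP[i _ /setP E]].
  by rewrite !inE.
have := E (inord (i.+1.-1 * d + (Ordinal d0).+1)).
by rewrite inE => /esym/negP; apply; apply: imset_f.
Qed.

Definition std_wpart n d (hd : (1 < d)%N) : wpart n d :=
  WPart (std_valP n hd).

Lemma std_blocks n d (hd : (1 < d)%N) :
  blocks (std_wpart n hd) =
    [set (k, None) | k in std_zero n d]
    |: [set [set (inord (i * d + j.+1), Some j%:R) | j : 'I_d]
        | i : 'I_(n %/ d)].
Proof.
have d0 := ltnW hd.
rewrite /blocks imsetU1 -imset_comp; congr (_ |: _).
  by apply: eq_in_imset => k kz; rewrite /= ffunE kz.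
apply: eq_imset => i; rewrite /wblock /= -imset_comp; apply: eq_imset => j /=.
have [_ E] := std_inord i j.
rewrite ffunE; case: ifPn => [kz|_].
  by case: (std_dis d0 kz (imset_f _ _)).
by rewrite E addnS /= natrD natrM pchar_Zp // mulr0 add0r.
Qed.

Definition std_dowling n d (hd : (1 < d)%N) : dowling n d :=
  dpi (std_wpart n hd).

(* Main.v *)
(* A coarser partition stays balanced because a nonzero block C of it is a      *)
(* union of shifted balanced blocks, which contribute to every weight of C      *)
(* equally.  Conversely, a balanced nonzero block splits into transversals,     *)
(* i.e. d-subsets on which every weight occurs once.  Listing the transversals  *)
(* one after the other, each in order of weights, and then the zero block gives *)
(* a permutation that takes the standard element below the given partition.     *)
(* Finally, the orbit is an antichain: if xs <= x then iterating the            *)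
(* order-preserving action of s, which has finite order, gives x <= xs.         *)

Require Import Defs.
From mathcomp Require Import all_boot all_order all_fingroup all_algebra.
From mathcomp Require Import zify.

Set Implicit Arguments.
Unset Strict Implicit.
Unset Printing Implicit Defensive.

Import Order.TTheory GRing.Theory.

(** Three facts suffice. Balance passes upward ([wle_balanced]) and holds on the orbit of the
    standard element ([std_balanced], [wact_balanced]), so everything above the orbit is balanced.
    Conversely, every balanced partition lies above a point of the orbit ([le_std_act], which rests
    on [transversals]). Finally, two comparable points of an orbit are equal ([dact_le_eq]), so the
    orbit is exactly the set of minimal balanced partitions. *)

(** * Splitting equidistributed fibres into transversals *)

(* Greedy: if A is nonempty, the fibre of b through one of its points has       *)
(* elements of every colour c; remove one of each colour.                       *)
Lemma transversals (T W : finType) (U : eqType) (b : T -> U) (c : T -> W)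
    (A : {set T}) :
  (forall u w w', #|[set x in A | (b x == u) && (c x == w)]| =
                  #|[set x in A | (b x == u) && (c x == w')]|) ->
  exists gs : seq {ffun W -> T},
    [/\ forall g, g \in gs ->
          exists u, forall w, [/\ g w \in A, b (g w) = u & c (g w) = w],
        uniq (flatten [seq [seq g w | w <- enum W] | g : {ffun W -> T} <- gs]) &
        flatten [seq [seq g w | w <- enum W] | g : {ffun W -> T} <- gs] =i A].
Proof.
have [m] := ubnP #|A|; elim: m A => // m IHm A ltAm eqA.
have [->|[x xA]] := set_0Vmem A.
  by exists [::]; split=> // x; rewrite inE.
have gP w : {y | [&& y \in A, b y == b x & c y == w]}.
  apply: sigW; suff: 0 < #|[set y in A | (b y == b x) && (c y == w)]|.
    by case/card_gt0P => y; rewrite inE; exists y.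
  by rewrite (eqA _ _ (c x)); apply/card_gt0P; exists x; rewrite inE xA !eqxx.
pose g := [ffun w => sval (gP w)].
have gA w : [/\ g w \in A, b (g w) = b x & c (g w) = w].
  by rewrite ffunE; case/and3P: (svalP (gP w)) => ? /eqP ? /eqP ?.
have ginj : injective g.
  by move=> w w' eg; have [_ _ <-] := gA w; rewrite eg; have [_ _ ->] := gA w'.
pose G := [set g w | w in W].
have GA : G \subset A by apply/subsetP => _ /imsetP[w _ ->]; case: (gA w).
(* [G] takes one point of each colour from the fibre over [b x] and none from the others, so
   [A :\: G] still satisfies the hypothesis. *)
have cardG u w :
  #|[set y in A :&: G | (b y == u) && (c y == w)]| = (u == b x).
  have [->|nu] := eqVneq u (b x).
    rewrite /= -(cards1 (g w)); apply: eq_card => y; rewrite !inE.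
    apply/andP/eqP => [[/andP[_ /imsetP[w' _ ->]]]|->].
      by case: (gA w') => _ _ -> /andP[_ /eqP ->].
    by case: (gA w) => -> -> ->; rewrite !eqxx imset_f.
  apply/eqP; rewrite cards_eq0; apply/eqP/setP => y; rewrite !inE.
  apply/negP => /andP[/andP[_ /imsetP[w' _ ->]]].
  by case: (gA w') => _ -> _ /andP[/eqP eu]; rewrite eu eqxx in nu.
have [||gs [gsP gsU gsE]] := IHm (A :\: G).
- rewrite -ltnS; apply: leq_trans ltAm; rewrite ltnS proper_card //.
  rewrite properE subsetDl; apply/subsetPn; exists (g (c x)).
    by case: (gA (c x)).
  by rewrite inE imset_f.
- move=> u w w'; have := eqA u w w'.
  have split v : #|[set y in A | (b y == u) && (c y == v)]| =
      (u == b x) + #|[set y in A :\: G | (b y == u) && (c y == v)]|.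
    rewrite -(cardG u v) -cardsUI [X in _ = _ + #|pred_of_set X|](_ : _ = set0).
      rewrite cards0 addn0; apply: eq_card => y; rewrite !inE.
      by case: (y \in G); case: (y \in A); case: (_ && _).
    by apply/setP => y; rewrite !inE; case: (y \in G); rewrite ?andbF.
  by rewrite !split => /addnI.
have memG y : (y \in [seq g w | w <- enum W]) = (y \in G).
  by apply/mapP/imsetP => -[w _ ->]; exists w; rewrite ?mem_enum.
exists (g :: gs); split=> /= [h||y].
- rewrite inE => /predU1P[->|/gsP[u uP]]; first by exists (b x).
  by exists u => w; case: (uP w) => /setDP[].
- rewrite cat_uniq gsU andbT map_inj_uniq // enum_uniq /=.
  by apply/hasPn => y; rewrite gsE memG inE => /andP[].
- rewrite mem_cat gsE memG inE.
  by have /subsetP/(_ y) := GA; case: (y \in G) => [->|_].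
Qed.

(** * Lists and permutations fixing 0 *)

(** The index [i * d + j] matches the numbering of the standard blocks. *)
Lemma nth_flatten_map (S T : Type) (r : S -> seq T) d (s : seq S) s0 x0 i j :
  (forall y, size (r y) = d) -> i < size s -> j < d ->
  nth x0 (flatten (map r s)) (i * d + j) = nth x0 (r (nth s0 s i)) j.
Proof.
move=> sz; elim: s i => [//|y s IHs] [|i] /= lti ltj; rewrite nth_cat sz.
  by rewrite ltj.
by rewrite mulSn -addnA ltnNge leq_addr /= addKn IHs.
Qed.

(** A permutation fixing 0 permutes the nonzero points, which [lift ord0] identifies with ['I_n]. *)
Lemma fix0_surj n (t : 'S_n.+1) : t ord0 = ord0 -> exists s, fix0 s = t.
Proof.
move=> t0; have tlift i : {j | t (lift ord0 i) = lift ord0 j}.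
  case: (unliftP ord0 (t (lift ord0 i))) => [j ->|]; first by exists j.
  by move/eqP; rewrite -{2}t0 (inj_eq perm_inj) eq_sym (negPf (neq_lift _ _)).
pose f i := sval (tlift i).
have fE i : t (lift ord0 i) = lift ord0 (f i) by rewrite /f; case: (tlift i).
have finj : injective f.
  by move=> i j eij; apply/(@lift_inj _ ord0)/(@perm_inj _ t); rewrite !fE eij.
exists (perm finj); apply/permP => i.
case: (unliftP ord0 i) => [j|] ->; last by rewrite lift_perm_id.
by rewrite lift_perm_lift permE fE.
Qed.

(** * Order and balance on underlying blocks *)

Section Blocks.

Variables n d : nat.
Implicit Types p q : wpart n d.

Definition wmult p (B : {set 'I_n.+1}) w := #|[set i in B | p.2 i == Some w]|.

Lemma wbalancedP p :
  reflect (forall B, B \in p.1 -> forall w w', wmult p B w = wmult p B w')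
          (wbalanced p).
Proof.
have cardE B w :
  #|[set x in wblock p B | x.2 == Some w]| = wmult p B w.
  have injp : injective (fun i => (i, p.2 i)) by move=> i j [].
  rewrite /wmult -(card_imset _ injp); apply: eq_card => x.
  rewrite !inE mem_wblock; apply/andP/imsetP => [[/andP[xB /eqP x2] xw]|].
    by exists x.1; rewrite ?inE ?xB -x2 //; case: (x).
  by case=> i; rewrite inE => /andP[iB iw] -> /=; rewrite iB eqxx.
apply: (iffP forall_inP) => bal B.
  move=> Bp w w'; have /forallP/(_ w)/forallP/(_ w')/eqP := bal _ (imset_f _ Bp).
  by rewrite !cardE.
case/imsetP => B0 B0p ->; apply/forallP => w; apply/forallP => w'.
by rewrite !cardE (bal _ B0p w w').
Qed.

(** The two alternatives are inclusion of the erased block and of a shift, read off the weight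
    functions. *)
Definition block_le p q (B C : {set 'I_n.+1}) : Prop :=
  B \subset C /\
  ((forall i, i \in B -> q.2 i = None) \/
   exists v, forall i, i \in B -> q.2 i = omap (fun u => u + v)%R (p.2 i)).

Lemma wle_blockP p q :
  wle p q <->
  (forall B, B \in p.1 -> exists2 C, C \in q.1 & block_le p q B C).
Proof.
split=> [/wleP le_pq B Bp|le_pq].
  have [_ /imsetP[C Cq ->] BC] := le_pq _ (imset_f _ Bp).
  exists C => //; case/orP: BC => [/subsetP sub|/existsP[v /subsetP sub]].
    have subi i : i \in B -> (i \in C) && (None == q.2 i).
      move=> iB; rewrite -(mem_wblock q C (i, None)); apply: sub.
      by apply/imsetP; exists (i, p.2 i); rewrite ?mem_wblock /= ?iB ?eqxx.
    by split; [apply/subsetP | left] => i /subi/andP[] // _ /eqP.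
  have subi i : i \in B ->
      (i \in C) && (omap (fun u => u + v)%R (p.2 i) == q.2 i).
    move=> iB; rewrite -(mem_wblock q C (i, _)); apply: sub.
    by apply/imsetP; exists (i, p.2 i); rewrite ?mem_wblock /= ?iB ?eqxx.
  by split; [apply/subsetP | right; exists v] => i /subi/andP[] // _ /eqP.
apply/wleP => _ /imsetP[B Bp ->]; have [C Cq [/subsetP BC w]] := le_pq B Bp.
exists (wblock q C); first exact: imset_f.
apply/orP; case: w => [w|[v w]]; [left|right; apply/existsP; exists v];
  apply/subsetP => _ /imsetP[x + ->]; rewrite !mem_wblock /= => /andP[xB xw].
  by rewrite BC // w.
by rewrite BC // w // (eqP xw) eqxx.
Qed.

(** The multiplicity of a weight in [C] is summed over the blocks [B] of [p]. A block outside [C],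
    or erased in it, contributes 0; a block shifted by [v] contributes its own multiplicity of the
    weight minus [v], which is the same for all weights. *)
Lemma wle_balanced p q : wle p q -> wbalanced p -> wbalanced q.
Proof.
move=> /wle_blockP le_pq /wbalancedP balp; apply/wbalancedP => C Cq w w'.
have multE v : wmult q C v =
    \sum_(B in p.1) #|[set i in B | (i \in C) && (q.2 i == Some v)]|.
  rewrite /wmult -sum1_card big_mkcond /=.
  rewrite (eq_bigl [in [set: 'I_n.+1]]); last by move=> i; rewrite inE.
  rewrite (set_partition_big _ (wpart_partition p)) /=.
  apply: eq_bigr => B _; rewrite -sum1_card -big_mkcondr /=.
  by apply: eq_bigl => i; rewrite !inE.
rewrite !multE; apply: eq_bigr => B Bp.
have [D Dq [/subsetP BD wB]] := le_pq B Bp.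
have [eCD|neCD] := eqVneq C D; last first.
  have notC i : i \in B -> i \in C = false.
    move=> /BD iD; apply/negP => iC; move: neCD.
    have /and3P[_ triv _] := wpart_partition q.
    by rewrite -(def_pblock triv Cq iC) (def_pblock triv Dq iD) eqxx.
  by apply: eq_card => i; rewrite !inE; case: (boolP (i \in B)) => // /notC ->.
case: wB => [wB|[v wB]].
  apply: eq_card => i; rewrite !inE; case: (boolP (i \in B)) => // /wB ->.
  by rewrite !andbF.
suff E u : #|[set i in B | (i \in C) && (q.2 i == Some u)]| =
           wmult p B (u - v)%R by rewrite !E (balp _ Bp (w - v)%R (w' - v)%R).
apply: eq_card => i; rewrite !inE; case: (boolP (i \in B)) => // iB.
rewrite eCD BD // wB //; case: (p.2 i) => //= a.
by rewrite !(inj_eq Some_inj) -[RHS]eq_sym subr_eq eq_sym.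
Qed.

Lemma wact_balanced p s : wbalanced p -> wbalanced (wact p s).
Proof.
move=> /wbalancedP balp; apply/wbalancedP => _ /imsetP[B Bp ->].
suff E w : wmult (wact p s) [set fix0 s i | i in B] w = wmult p B w.
  by move=> w w'; rewrite !E; apply: balp.
rewrite /wmult -[RHS](card_imset _ (@perm_inj _ (fix0 s))).
apply: eq_card => i; rewrite inE /= ffunE -{1 3}(permKV (fix0 s) i).
by rewrite !(mem_imset _ _ (@perm_inj _ _)) inE.
Qed.

Lemma std_balanced (hd : 1 < d) : wbalanced (std_wpart n hd).
Proof.
apply/forall_inP => B; rewrite std_blocks => /setU1P[->|/imsetP[i _ ->]].
  (* No element of the zero block carries a weight, so both sets are empty. *)
  do 2!apply/forallP => ?; apply/eqP.
  by apply: eq_card => x; rewrite !inE; apply/andP/andP => -[/imsetP[k _ ->]].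
suff E w : #|[set x in [set (@inord n (i * d + j.+1), Some (j%:R : 'Z_d)%R)
                       | j : 'I_d] | x.2 == Some w]| = 1.
  by do 2!apply/forallP => ?; rewrite !E.
have ltwd : w < d by rewrite -[ltnRHS]Zp_cast.
rewrite -(cards1 (@inord n (i * d + w.+1), Some w)); apply: eq_card => x.
rewrite !inE; apply/andP/eqP => [[/imsetP[j _ ->]] /= /eqP[<-]|->].
  by rewrite val_Zp_nat // modn_small.
split=> //; apply/imsetP; exists (Ordinal ltwd) => //=.
by rewrite natr_Zp.
Qed.

End Blocks.

(** * A point of the orbit below each balanced partition *)

Lemma le_std_act n d (hd : 1 < d) (p : wpart n d) :
  wbalanced p -> exists s, wle (wact (std_wpart n hd) s) p.
Proof.
(* Once [d] has the form [d.+2], ['Z_d.+2] is ['I_d.+2] by conversion, and an index in a standard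
   block serves as a weight. *)
case: d hd p => [|[|d]] // hd p /wbalancedP balp.
have /and3P[/eqP cov triv _] := wpart_partition p.
have mem_own i : i \in pblock p.1 i by rewrite mem_pblock cov inE.
have ownP i : pblock p.1 i \in p.1 by apply: pblock_mem; rewrite cov inE.
pose A := [set i | p.2 i != None]; pose Z := pblock p.1 ord0.
have AZ i : (i \in A) = (i \notin Z) by rewrite inE wpart_None.
(* The default 0 is never reached on [A]. *)
pose c i := odflt 0%R (p.2 i).
(* [transversals] quantifies over all sets [u]; those that are not blocks have empty fibres. *)
have multE u w : #|[set i in A | (pblock p.1 i == u) && (c i == w)]| =
    if u \in p.1 then wmult p u w else 0.
  case: ifPn => [up|nup].
    apply: eq_card => i; rewrite !inE /c.
    have -> : (pblock p.1 i == u) = (i \in u).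
      by apply/eqP/idP => [<- //|]; apply: def_pblock.
    by case: (p.2 i) => [v|]; rewrite /= ?andbF.
  apply/eqP; rewrite cards_eq0; apply/eqP/setP => i; rewrite !inE.
  by apply: contraNF nup => /and3P[_ /eqP <- _].
have [|gs [gsP]] := @transversals _ 'Z_d.+2 _ (pblock p.1) c A.
  by move=> u w w'; rewrite !multE; case: ifP => // /balp.
pose r (g : {ffun 'Z_d.+2 -> 'I_n.+1}) := [seq g w | w <- enum 'Z_d.+2].
rewrite -/(map r gs); set L := flatten _ => Luniq memL.
have sizer g : size (r g) = d.+2 by rewrite size_map size_enum_ord.
have sizeL : size L = size gs * d.+2.
  rewrite /L; elim: (gs) => //= g gs' IH.
  by rewrite size_cat IH sizer mulSn.
(* s will map k to the k-th entry of this list *)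
pose L' := ord0 :: L ++ enum (Z :\ ord0).
have L'uniq : uniq L'.
  rewrite /= cat_uniq Luniq enum_uniq mem_cat memL AZ mem_own mem_enum !inE /=.
  rewrite andbT; apply/hasPn => i.
  by rewrite mem_enum memL AZ !inE negbK => /andP[].
have memL' i : i \in L'.
  rewrite inE mem_cat memL AZ mem_enum !inE.
  by case: (i == ord0); case: (i \in Z).
have sizeL' : size L' = n.+1.
  rewrite -(card_uniqP L'uniq) -[RHS]card_ord.
  by apply: eq_card => i; rewrite memL' inE.
have tinj : injective (fun i : 'I_n.+1 => nth ord0 L' i).
  move=> i j /eqP; rewrite nth_uniq ?sizeL' // => /eqP; apply: val_inj.
have [|s sE] := @fix0_surj n (perm tinj); first by rewrite permE.
exists s; apply/wle_blockP => _ /imsetP[B Bstd ->].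
have sL i : fix0 s i = nth ord0 L' i by rewrite sE permE.
have wE i : (wact (std_wpart n hd) s).2 (fix0 s i) = (std_wpart n hd).2 i.
  by rewrite ffunE permK.
have sZ i : (i == ord0) || (size L < i) -> fix0 s i \in Z.
  rewrite sL; case/orP => [/eqP -> //|]; case: i => -[|i] //= lti ltLi.
  rewrite nth_cat ltnNge -ltnS ltLi /=.
  have : nth ord0 (enum (Z :\ ord0)) (i - size L) \in enum (Z :\ ord0).
    apply: mem_nth; move: sizeL' lti ltLi; rewrite /= size_cat; lia.
  by rewrite mem_enum inE => /andP[].
(* The transversals are disjoint sets of [d.+2] nonzero points. They may number fewer than
   [n %/ d.+2] when the zero block is large. *)
have leL : size gs <= n %/ d.+2.
  rewrite leq_divRL // -sizeL; move: sizeL'; rewrite /= size_cat; lia.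
(* Positions beyond [L] are sent into [Z], where weights are erased. This covers the standard zero
   block and the standard blocks left without a transversal. *)
have ZB (B' : {set 'I_n.+1}) :
    (forall i, i \in B' -> (i == ord0) || (size L < i)) ->
    exists2 C, C \in p.1 &
      block_le (wact (std_wpart n hd) s) p [set fix0 s i | i in B'] C.
  move=> B'P; exists Z; first exact: ownP.
  have sub i : i \in [set fix0 s i | i in B'] -> i \in Z.
    by case/imsetP => k /B'P/sZ kZ ->.
  split; first exact/subsetP.
  by left=> i /sub; rewrite /Z -wpart_None => /eqP.
case/setU1P: Bstd => [->|/imsetP[k _ ->]].
  apply: ZB => i; rewrite inE => /orP[->//|lti]; apply/orP; right.
  by rewrite sizeL; apply: leq_ltn_trans lti; rewrite leq_mul2r leL orbT.
have [ltk|lek] := ltnP k (size gs); last first.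
  apply: ZB => i; rewrite std_blockP // -lt0n => /andP[i0 /eqP ik].
  apply/orP; right; rewrite -[X in _ < X]prednK // ltnS sizeL.
  by rewrite -leq_divRL // ik.
pose g0 : {ffun 'Z_d.+2 -> 'I_n.+1} := [ffun=> ord0].
pose g := nth g0 gs k.
have [u uP] : exists u, forall w,
    [/\ g w \in A, pblock p.1 (g w) = u & c (g w) = w].
  exact/gsP/mem_nth.
have sg i : i \in std_block n d.+2 k.+1 ->
    exists2 w : 'Z_d.+2, fix0 s i = g w & (std_wpart n hd).2 i = Some w.
  move=> ik; case/imsetP: (ik) => j _ ei; have [_ iE] := std_inord k j.
  have i_val : i = (k * d.+2 + j.+1)%N :> nat by rewrite ei iE.
  exists (j : 'Z_d.+2).
    (* The leading [ord0] of [L'] absorbs the successor in [j.+1]. *)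
    rewrite sL i_val addnS /= nth_cat sizeL.
    have -> : k * d.+2 + j < size gs * d.+2.
      apply: leq_trans (_ : k.+1 * d.+2 <= _); last by rewrite leq_mul2r ltk orbT.
      by rewrite mulSn addnC ltn_add2r.
    rewrite (nth_flatten_map g0) // (nth_map j) ?size_enum_ord //.
    by rewrite nth_ord_enum.
  rewrite ffunE; case: ifPn => [iz|_]; first by case: (std_dis _ iz ik).
  by rewrite i_val addnS /= natrD natrM pchar_Zp // mulr0 add0r natr_Zp.
exists u; first by case: (uP 0%R) => _ <- _.
split.
  by apply/subsetP => _ /imsetP[i /sg[w -> _] ->]; case: (uP w) => _ <-.
(* Transversals are listed in order of weight, so the weights already agree without a shift. *)
right; exists 0%R => _ /imsetP[i ik ->]; rewrite wE.
have [w -> ->] := sg _ ik; case: (uP w) => + _; rewrite inE /c /=.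
by case: (p.2 _) => //= v _ ->; rewrite addr0.
Qed.

(** * Minimality of the orbit *)

Lemma le_dact n d (x y : dowling n d) s :
  (x <= y)%O -> (dact x s <= dact y s)%O.
Proof. by rewrite -[x]dpi_repr -[y]dpi_repr !dactE !le_dpi; apply: wle_act. Qed.

Lemma dact_le_eq n d (x : dowling n d) s : (dact x s <= x)%O -> dact x s = x.
Proof.
move=> le_s; apply/eqP; rewrite eq_le le_s /=.
have lek k : (dact x (s ^+ k.+1)%g <= dact x s)%O.
  elim: k => [|k IHk]; first by rewrite expg1.
  by rewrite expgSr dactM; apply/le_dact/(le_trans IHk).
(* Taking the order of [s] as exponent turns the bound into [x <= dact x s]. *)
by have := lek #[s]%g.-1; rewrite prednK // expg_order dact1.
Qed.

Theorem proposition9p3 (n d : nat) (hd : (1 < d)%N) :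
  [/\ upper_order_ideal (balanced_partitions n d),
      balanced_partitions n d =
        upper_ideal_gen (orbit (dowling_action n d) [set: 'S_n] (std_dowling n hd))
    & generators (balanced_partitions n d) =
        orbit (dowling_action n d) [set: 'S_n] (std_dowling n hd)].
Proof.
set O := orbit _ _ _.
have up : upper_order_ideal (balanced_partitions n d).
  by move=> x y; rewrite !inE => balx le_xy; apply: wle_balanced le_xy balx.
have Obal x : x \in O -> x \in balanced_partitions n d.
  case/orbitP => s _ <-; rewrite inE /= /std_dowling dactE balancedE.
  exact/wact_balanced/std_balanced.
have Ole y : y \in balanced_partitions n d -> exists2 x, x \in O & (x <= y)%O.
  rewrite inE -[y]dpi_repr balancedE => /(le_std_act hd)[s le_s].
  exists (dact (std_dowling n hd) s); last by rewrite dactE le_dpi.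
  by apply/orbitP; exists s; rewrite ?inE.
split=> //; apply/setP => y.
  rewrite [RHS]inE; apply/idP/exists_inP => [/Ole[x xO xy]|[x /Obal]].
    by exists x.
  exact: up.
rewrite inE; apply/andP/idP => [[/Ole[x xO xy] /forall_inP ymin]|yO].
  by have /implyP/(_ xy)/eqP <- := ymin _ (Obal _ xO).
split; first exact: Obal.
apply/forall_inP => z /Ole[x xO xz]; apply/implyP => zy.
(* The orbit point [x] below [z] is a translate of [y] lying below [y], hence is [y], and [z] is
   squeezed between them. *)
have /orbitP[s _ sE] : x \in orbit (dowling_action n d) [set: 'S_n] y.
  by have /orbit_eqP -> := yO.
have xy := le_trans xz zy; move: xy xz; rewrite -sE /= => /dact_le_eq -> yz.
by rewrite eq_le zy.
Qed.
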